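(* Let $k\geq 4$ be an integer. On every instance of $\mathsf{k\,CSP\!-\!2}$ with strong chromatic number $\nu\geq k$, the average differential ratio is at least $$\frac{1}{2^{\lceil\log_2(\nu+1)\rceil k/2}}\ \geq\ \frac{1}{(2\nu)^{k/2}}\quad\text{if $k$ is even},$$ $$\frac12\times\frac{1}{2^{\lceil\log_2\nu\rceil(k-1)/2}}\ \geq\ \frac12\times\frac{1}{(2\nu)^{(k-1)/2}}\quad\text{if $k$ is odd}.$$
   Context: Let $\Sigma_q=\{0,1,\ldots,q-1\}$ and $[n]=\{1,\ldots,n\}$. An instance $I$ of $\mathsf{k\,CSP\!-\!q}$ (here $q=2$) consists of integers $n,m\ge 1$, a goal (maximize or minimize) and, for each $i\in[m]$, a weight $w_i>0$, an integer $1\le k_i\leq \min\{k,n\}$, a strictly increasing sequence $J_i=(i_1,\ldots,i_{k_i})$ of indices of $[n]$, and a function $P_i:\Sigma_q^{k_i}\to\mathbb{R}$. Solutions are vectors $x\in\Sigma_q^n$, with value $v(I,x)=\sum_{i=1}^m w_iP_i(x_{i_1},\ldots,x_{i_{k_i}})$. $\mathrm{opt}(I)$ and $\mathrm{wor}(I)$ are the best and worst solution values (maximum and minimum of $v(I,\cdot)$ if maximizing, minimum and maximum if minimizing). The average differential ratio on $I$ is $(\mathbb{E}_X[v(I,X)]-\mathrm{wor}(I))/(\mathrm{opt}(I)-\mathrm{wor}(I))$ with $X$ uniform on $\Sigma_q^n$ (considered when $\mathrm{opt}(I)\neq\mathrm{wor}(I)$). The strong chromatic number of $I$ is the smallest $\nu$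 such that there is a partition of $[n]$ into $\nu$ sets such that each $J_i$ contains at most one index from each set. *)

(* Defs.v *)
From HB Require Import structures.
From mathcomp Require Import all_boot all_order all_algebra.
From mathcomp Require Import reals exp.

Set Implicit Arguments.
Unset Strict Implicit.
Unset Printing Implicit Defensive.

Import Order.TTheory GRing.Theory Num.Theory.
Local Open Scope ring_scope.

Inductive goal := Maximize | Minimize.

(* Instances of k CSP-q. Indices start at 0: variables are 'I_nvars and the
   alphabet Sigma_q is 'I_q. The sequence J_i is the strictly increasing map
   scope i : 'I_(arity i) -> 'I_nvars. *)
Record csp (R : realType) (k q : nat) := Csp {
  nvars : nat;
  ncons : nat;
  nvars_gt0 : (1 <= nvars)%N;
  ncons_gt0 : (1 <= ncons)%N;
  csp_goal : goal;
  weight : 'I_ncons -> R;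
  weight_gt0 : forall i, 0 < weight i;
  arity : 'I_ncons -> nat;
  arity_bounds : forall i, (1 <= arity i <= minn k nvars)%N;
  scope : forall i, 'I_(arity i) -> 'I_nvars;
  scope_incr : forall i (a b : 'I_(arity i)),
    (a < b)%N -> (scope a < scope b)%N;
  payoff : forall i, {ffun 'I_(arity i) -> 'I_q} -> R
}.

Definition solution (R : realType) (k q : nat) (I : csp R k q) :=
  {ffun 'I_(nvars I) -> 'I_q}.

Definition value (R : realType) (k q : nat) (I : csp R k q)
    (x : solution I) : R :=
  \sum_(i < ncons I)
    weight i * payoff [ffun a : 'I_(arity i) => x (scope a)].

(* The default solution only serves as the starting element of an iterated max
   or min that ranges over all solutions. *)
Definition default_solution (R : realType) (k q : nat) (I : csp R k q.+1) : solution I :=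
  [ffun=> ord0].

Definition max_value (R : realType) (k q : nat) (I : csp R k q.+1) : R :=
  \big[Num.max/value (default_solution I)]_(x : solution I) value x.

Definition min_value (R : realType) (k q : nat) (I : csp R k q.+1) : R :=
  \big[Num.min/value (default_solution I)]_(x : solution I) value x.

Definition opt (R : realType) (k q : nat) (I : csp R k q.+1) : R :=
  match csp_goal I with
  | Maximize => max_value I
  | Minimize => min_value I
  end.

Definition wor (R : realType) (k q : nat) (I : csp R k q.+1) : R :=
  match csp_goal I with
  | Maximize => min_value I
  | Minimize => max_value I
  end.

Definition mean_value (R : realType) (k q : nat) (I : csp R k q) : R :=
  (\sum_(x : solution I) value x) / #|{: solution I}|%:R.

Definition average_differential_ratio (R : realType) (k q : nat)
    (I : csp R k q.+1) : R :=
  (mean_value I - wor I) / (opt I - wor I).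

Definition scope_set (R : realType) (k q : nat) (I : csp R k q)
    (i : 'I_(ncons I)) : {set 'I_(nvars I)} :=
  [set scope a | a : 'I_(arity i)].

Definition strong_coloring (R : realType) (k q : nat) (I : csp R k q)
    (P : {set {set 'I_(nvars I)}}) : bool :=
  partition P [set: 'I_(nvars I)] &&
  [forall i : 'I_(ncons I), forall B in P, #|scope_set i :&: B| <= 1]%N.

Definition strongly_colorable (R : realType) (k q : nat) (I : csp R k q)
    (nu : nat) : bool :=
  [exists P : {set {set 'I_(nvars I)}}, strong_coloring P && (#|P| == nu)].

Lemma strongly_colorable_ex (R : realType) (k q : nat) (I : csp R k q) :
  exists nu, strongly_colorable I nu.
Proof.
set P := preim_partition (fun j : 'I_(nvars I) => j) [set: 'I_(nvars I)].
have partP : partition P [set: 'I_(nvars I)] by exact: preim_partitionP.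
exists #|P|; apply/existsP; exists P; rewrite eqxx andbT /strong_coloring partP.
apply/forallP => i; apply/forall_inP => B BP.
apply: leq_trans (subset_leq_card (subsetIr _ _)) _.
apply/card_le1_eqP => a b aB bB; move/imsetP: BP aB bB => [c _ ->].
by rewrite !inE /= => /eqP <- /eqP.
Qed.

Definition strong_chromatic_number (R : realType) (k q : nat)
    (I : csp R k q) : nat :=
  ex_minn (strongly_colorable_ex I).

Definition log2 (R : realType) (x : R) : R := ln x / ln 2.

(* Main.v *)
Require Import Defs.
From HB Require Import structures.
From mathcomp Require Import all_boot all_order all_algebra all_field.
From mathcomp Require Import reals exp.

Set Implicit Arguments.
Unset Strict Implicit.
Unset Printing Implicit Defensive.

Import Order.TTheory GRing.Theory Num.Theory.
Local Open Scope ring_scope.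

(** The theorem holds because every solution can be dragged through a small
    orthogonal array. Colour the variables with [nu] colours so that no
    constraint sees a colour twice, and suppose that [M] is an array of [N] rows
    of [nu] bits of strength [k], meaning that every [k] of its columns carry
    each bit pattern equally often. Shift an optimal solution by the rows of
    [M], a variable of colour [c] being shifted by the entry of column [c]. A
    constraint reads at most [k] columns, so over the [N] shifted solutions it
    takes its average value, and the mean of the instance is the mean of these
    [N] solutions. Up to a common shift one of them is the optimum, and the
    others are no worse than the worst solution: the average differential
    ratio is at least [1 / N] ([average_differential_ratio_ge]).

    It remains to find arrays with few rows. For even strength [2 t] and
    [nu < 2 ^ m], the dual of the BCH code has [2 ^ (m * t)] rows: its columns
    are indexed by the nonzero elements [x] of the field with [2 ^ m] elements,
    its rows by odd polynomials [r] of degree below [2 t], and its entries are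
    [l (r x)] for a fixed nonzero additive [l] from the field to the two-element
    field ([unbiased_bch]). Its strength comes from power sums: if the
    columns in [S] added up to zero, all the odd power sums of [S] below degree
    [2 t] would vanish, hence by squaring also the even ones, which is
    impossible for a nonempty [S] of at most [2 t] elements
    ([odd_power_sum_neq0]). Strength [2 t + 1] costs one more bit and gives one
    more column ([unbiased_double]), whence the factor [1 / 2] for odd [k].

    Taking [m] minimal gives [m] as the ceiling of the logarithm in the
    statement ([ceil_log2]), and minimality gives [2 ^ m <= 2 * nu]. *)

(** * Signs and unbiased arrays *)

Definition sgn (R : pzRingType) (b : 'I_2) : R := (-1) ^+ b.

Lemma sgnD (R : pzRingType) (a b : 'I_2) : sgn R (a + b) = sgn R a * sgn R b.
Proof.
rewrite /sgn -exprD.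
by case: a b => [[|[|a]] //= ?] [[|[|b]] //= ?]; rewrite // sqrrN expr1n.
Qed.

Lemma sgn0 (R : pzRingType) : sgn R 0 = 1.
Proof. by []. Qed.

Lemma sgn_sum (R : pzRingType) (I : finType) (S : {set I}) (x : I -> 'I_2) :
  sgn R (\sum_(i in S) x i) = \prod_(i in S) sgn R (x i).
Proof. by apply: big_morph => // a b; rewrite sgnD. Qed.

(** The Fourier form of being an orthogonal array of strength [k] with rows
    indexed by [T] and columns by [I]: no parity of at least one and at most
    [k] columns is biased. [unbiased_uniform] gives back the usual form. *)
Definition unbiased (R : pzRingType) (k : nat) (T I : finType)
    (M : T -> I -> 'I_2) :=
  forall S : {set I}, (0 < #|S| <= k)%N ->
    \sum_r \prod_(i in S) sgn R (M r i) = 0.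

Lemma sum_antisymmetric (R : numDomainType) (T : finType) (h : T -> T)
    (f : T -> R) :
  injective h -> (forall r, f (h r) = - f r) -> \sum_r f r = 0.
Proof.
move=> h_inj fh; suff: (\sum_r f r) *+ 2 == 0 by rewrite mulrn_eq0 => /eqP.
rewrite mulr2n {1}(reindex_inj h_inj) -big_split big1 //= => r _.
by rewrite fh addNr.
Qed.

Lemma sgn_indicator (R : comPzRingType) (I : finType) (b c : {ffun I -> 'I_2}) :
  \prod_i (sgn R (b i) * sgn R (c i) + 1) = 2 ^+ #|I| *+ (c == b).
Proof.
have factor (u v : 'I_2) : sgn R u * sgn R v + 1 = 2 *+ (v == u).
  case: u v => [[|[|u]] //= ?] [[|[|v]] //= ?]; rewrite /sgn /= ?expr0 ?expr1;
    by rewrite ?mulN1r ?mul1r ?opprK ?addNr // mulr1n.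
under eq_bigr do rewrite factor.
have [->|neq] := eqVneq c b.
  by under eq_bigr do rewrite eqxx mulr1n; rewrite prodr_const mulr1n.
have [i ci] : exists i, c i != b i.
  by apply/existsP; apply: contraNT neq => /existsPn eqi;
     apply/eqP/ffunP => i; apply/eqP; rewrite -[_ == _]negbK eqi.
by rewrite (bigD1 i) //= (negbTE ci) mulr0n mul0r.
Qed.

(** Expanding the indicator of each bit pattern into characters
    ([sgn_indicator]) leaves only the empty product after summation over the
    rows, so all patterns are equally frequent. *)
Lemma unbiased_uniform (R : comPzRingType) (k : nat) (T I : finType)
    (M : T -> I -> 'I_2) (f : {ffun I -> 'I_2} -> R) :
  (#|I| <= k)%N -> unbiased R k M ->
  (\sum_r f [ffun i => M r i]) * 2 ^+ #|I| = #|T|%:R * \sum_b f b.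
Proof.
move=> leIk M0.
have count b : \sum_r 2 ^+ #|I| *+ ([ffun i => M r i] == b) = #|T|%:R :> R.
  under eq_bigr => r _ do rewrite -sgn_indicator bigA_distr /=.
  (* Only the trivial character, indexed by the empty set, contributes. *)
  rewrite exchange_big (bigD1 set0) //= [X in _ + X]big1 => [|S nzS].
    rewrite addr0 -sum1_card natr_sum; apply: eq_bigr => r _.
    by rewrite big1 // => i; rewrite inE.
  under eq_bigr => r _.
    rewrite -big_mkcond big_split /=.
    under [X in _ * X]eq_bigr do rewrite ffunE.
    over.
  by rewrite -mulr_sumr M0 ?mulr0 // card_gt0 nzS (leq_trans (max_card _)).
rewrite mulr_sumr; under [RHS]eq_bigr => b _ do rewrite -(count b) mulr_suml.
rewrite exchange_big mulr_suml; apply: eq_bigr => r _.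
set c := [ffun i => M r i].
rewrite (bigD1 c) //= eqxx mulr1n big1 ?addr0 1?mulrC // => b.
by rewrite eq_sym => /negbTE->; rewrite mul0r.
Qed.

Lemma unbiased_col (R : comPzRingType) (k : nat) (T I J : finType)
    (M : T -> I -> 'I_2) (g : J -> I) :
  injective g -> unbiased R k M -> unbiased R k (fun r j => M r (g j)).
Proof.
move=> g_inj M0 S; rewrite -(card_imset _ g_inj) => /M0 MS.
rewrite -[RHS]MS; apply: eq_bigr => r _; rewrite big_imset //=.
by move=> x y _ _; apply: g_inj.
Qed.

Lemma unbiased_shift (R : comPzRingType) (k : nat) (T I : finType)
    (M : T -> I -> 'I_2) (s : I -> 'I_2) :
  unbiased R k M -> unbiased R k (fun r i => s i + M r i).
Proof.
move=> M0 S /M0 MS; under eq_bigr => r _.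
  under eq_bigr do rewrite sgnD.
  rewrite big_split /=; over.
by rewrite -mulr_sumr MS mulr0.
Qed.

Lemma unbiased_leq (R : pzRingType) (j k : nat) (T I : finType)
    (M : T -> I -> 'I_2) :
  (j <= k)%N -> unbiased R k M -> unbiased R j M.
Proof.
by move=> jk M0 S /andP[S0 Sj]; rewrite M0 // S0 (leq_trans Sj).
Qed.

(** Flipping one coordinate in [S] reverses the sign of the product. *)
Lemma unbiased_full (R : numDomainType) (k : nat) (I : finType) :
  unbiased R k (fun (x : {ffun I -> 'I_2}) i => x i).
Proof.
move=> S /andP[/card_gt0P[i0 i0S] _].
pose e : {ffun I -> 'I_2} := [ffun i => (i == i0)%:R].
apply: (@sum_antisymmetric R {ffun I -> 'I_2} (fun x => x + e)).
  exact: addIr.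
move=> x; under eq_bigr do rewrite ffunE sgnD.
have eS : \sum_(i in S) e i = 1.
  rewrite (bigD1 i0) //= ffunE eqxx big1 ?addr0 // => i /andP[_ /negbTE neq].
  by rewrite ffunE neq.
by rewrite big_split /= -(sgn_sum R S e) eS mulrN1.
Qed.

Lemma big_option (V : Type) (idx : V) (op : Monoid.com_law idx) (I : finType)
    (F : option I -> V) :
  \big[op/idx]_o F o = op (F None) (\big[op/idx]_i F (Some i)).
Proof.
rewrite (bigD1 None) //=; congr (op _ _).
rewrite (reindex_omap Some id) => [|[i|] //].
by apply: eq_bigl => i; rewrite /= eqxx.
Qed.

(** Adding a new bit [c] to every column, and [c] itself as a new column, kills
    the parities of odd size by flipping [c]. A parity of even size does not
    see [c]: it is a parity of at most [2 t] old columns, and still at least one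
    since an even nonempty set of columns cannot be the new column alone. *)
Lemma unbiased_double (R : numDomainType) (t : nat) (T I : finType)
    (M : T -> I -> 'I_2) :
  unbiased R t.*2 M ->
  unbiased R t.*2.+1 (fun (rc : T * 'I_2) (o : option I) =>
                  oapp (M rc.1) 0 o + rc.2).
Proof.
move=> M0 S /andP[S0 leS].
have prodE r c : \prod_(o in S) sgn R (oapp (M r) 0 o + c) =
    (\prod_(o in S) sgn R (oapp (M r) 0 o)) * sgn R c ^+ #|S|.
  by under eq_bigr do rewrite sgnD; rewrite big_split /= prodr_const.
have [oddS|evenS] := boolP (odd #|S|).
  apply: (@sum_antisymmetric R (T * 'I_2)%type (fun rc => (rc.1, rc.2 + 1))).
    move=> [r c] [r' c'] /= eq_rc; congr (_, _).
      exact: (congr1 (@fst T 'I_2) eq_rc).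
    exact: addIr 1 _ _ (congr1 (@snd T 'I_2) eq_rc).
  move=> [r c] /=; rewrite !prodE sgnD exprMn [sgn R 1]/sgn /= expr1.
  by rewrite -signr_odd oddS expr1 mulrN1 mulrN.
rewrite -(pair_bigA _
  (fun r c => \prod_(o in S) sgn R (oapp (M r) 0 o + c))) /=.
rewrite exchange_big big1 //= => c _.
under eq_bigr do rewrite prodE.
rewrite -mulr_suml; pose S' := [set i | Some i \in S].
have cardS : #|S| = ((None \in S) + #|S'|)%N.
  rewrite -!sum1_card !big_mkcond /= big_option /=; congr (_ + _)%N.
  by rewrite [RHS]big_mkcond; apply: eq_bigr => i _; rewrite inE.
suff -> : \sum_r \prod_(o in S) sgn R (oapp (M r) 0 o) = 0 by rewrite mul0r.
rewrite -[RHS](M0 S').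
  apply: eq_bigr => r _; rewrite big_mkcond big_option /= sgn0 if_same mul1r.
  by rewrite [RHS]big_mkcond; apply: eq_bigr => i _; rewrite inE.
move: S0 leS evenS; rewrite cardS; case: (None \in S) => /=.
  by rewrite !add1n negbK => _; rewrite ltnS => ->; case: #|S'|.
rewrite !add0n => ->; rewrite leq_eqVlt => /orP[/eqP->|//].
by rewrite /= odd_double.
Qed.

(** * Dual BCH codes *)

(** A coordinate function of the field seen as a vector space over its prime
    field, used in the place of the trace. *)
Lemma additive_functional (F : finFieldType) : 2 \in [pchar F] ->
  exists (l : F -> 'I_2) (z : F), {morph l : x y / x + y} /\ l z = 1.
Proof.
move=> char2; pose L := pPrimeCharType char2.
pose X := vbasis (@fullv _ L).
have dim_gt0 : (0 < \dim (@fullv _ L))%N.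
  rewrite lt0n dimv_eq0; apply/eqP => full0.
  have := memvf (1 : L); rewrite full0 memv0.
  by rewrite (negbTE (oner_neq0 F)).
pose i := Ordinal dim_gt0.
exists (fun x => coord X i (x : L)), (X`_i : L); split.
  by move=> x y; exact: (linearD (coord X i)).
by rewrite coord_free ?eqxx // (basis_free (vbasisP _)).
Qed.

(** In characteristic 2 the power sums satisfy [p_(2 e) = p_e ^ 2], so if the
    odd ones vanish below degree [2 t] then so do all of degree 1 to [2 t]. The
    sum of [x * q x] over [S] then vanishes for every polynomial [q] of degree
    below [2 t]; the [q] whose roots are all the points of [S] but one
    contradicts this, because that point is not zero. *)
Lemma odd_power_sum_neq0 (F : finFieldType) (t : nat)
    (S : {set {x : F | x != 0}}) :
  2 \in [pchar F] -> (0 < #|S| <= t.*2)%N ->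
  exists j : 'I_t, \sum_(x in S) val x ^+ j.*2.+1 != 0.
Proof.
move=> char2 /andP[S0 leS]; apply/existsP; apply: contraT => /existsPn odd0.
have power0 e : (0 < e <= t.*2)%N -> \sum_(x in S) val x ^+ e = 0.
  elim/ltn_ind: e => e IH /andP[e0 le_e].
  have [odd_e|even_e] := boolP (odd e).
    have e_half : e = e./2.*2.+1 by rewrite -{1}[e]odd_double_half odd_e.
    have lt_j : (e./2 < t)%N by rewrite -ltn_double -[_.*2.+1]e_half.
    by apply/eqP; move: (odd0 (Ordinal lt_j)); rewrite negbK /= -e_half.
  have e_half : e = e./2.*2 by rewrite -{1}[e]odd_double_half (negbTE even_e).
  have h0 : (0 < e./2)%N by rewrite -double_gt0 -e_half.
  have lt_h : (e./2 < e)%N.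
    by rewrite {2}e_half -addnn -[X in (X < _)%N]addn0 ltn_add2l.
  have sq : \sum_(x in S) val x ^+ e = (\sum_(x in S) val x ^+ e./2) ^+ 2.
    rewrite -(pFrobenius_autE char2) rmorph_sum; apply: eq_bigr => x _.
    by rewrite /= pFrobenius_autE -exprM muln2 -e_half.
  by rewrite sq IH ?expr0n // h0 (leq_trans (ltnW lt_h)).
have poly0 (q : {poly F}) : (size q <= t.*2)%N ->
    \sum_(x in S) val x * q.[val x] = 0.
  move=> le_q; under eq_bigr do rewrite (horner_coef_wide _ le_q) mulr_sumr.
  rewrite exchange_big big1 //= => i _.
  under eq_bigr do rewrite mulrCA -exprS.
  by rewrite -mulr_sumr power0 ?mulr0 // ltn_ord.
have [x0 x0S] := card_gt0P S0.
pose q : {poly F} := \prod_(y in S :\ x0) ('X - (val y)%:P).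
have size_q : (size q <= t.*2)%N.
  rewrite /q -big_enum size_prod_XsubC -cardE.
  by rewrite (leq_trans _ leS) // (cardsD1 x0 S) x0S.
have := poly0 q size_q; rewrite (bigD1 x0) //= big1 ?addr0.
  move/eqP; rewrite mulf_eq0 (negbTE (valP x0)) /= /q horner_prod.
  apply: contraTT => _; apply/prodf_neq0 => y; rewrite !inE => /andP[neq _].
  by rewrite hornerXsubC subr_eq0 eq_sym (inj_eq val_inj).
move=> x /andP[xS neq]; apply/eqP; rewrite mulf_eq0; apply/orP; right.
rewrite /q horner_prod; apply/prodf_eq0; exists x; first by rewrite !inE neq.
by rewrite hornerXsubC subrr.
Qed.

Lemma exists_injection (A B : finType) :
  (#|A| <= #|B|)%N -> exists g : A -> B, injective g.
Proof.
move=> leAB; exists (fun a => enum_val (widen_ord leAB (enum_rank a))).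
by move=> a b /enum_val_inj/(congr1 val)/= /val_inj/enum_rank_inj.
Qed.

(** The map sending a row to the parity of its entries in [S] is additive, so
    it is unbiased as soon as some row [r0] has odd parity. With [p] a nonzero
    odd power sum of [S], of degree [2 j + 1], and [l z = 1], the row of the
    polynomial [(z / p) X ^ (2 j + 1)] is such an [r0]. *)
Lemma unbiased_bch (R : numDomainType) (m t nu : nat) :
  (0 < m)%N -> (nu < 2 ^ m)%N ->
  exists (T : finType) (M : T -> 'I_nu -> 'I_2),
    #|T| = (2 ^ (m * t))%N /\ unbiased R t.*2 M.
Proof.
move=> m0 lt_nu; have [F char2 cardF] := pPrimePowerField (isT : prime 2) m0.
have [l [z [lD lz]]] := additive_functional char2.
have l0 : l 0 = 0 by apply: (addrI (l 0)); rewrite -lD !addr0.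
have lsum (I : finType) (P : pred I) (f : I -> F) :
    l (\sum_(i | P i) f i) = \sum_(i | P i) l (f i) by apply: big_morph.
have [g g_inj] : exists g : 'I_nu -> {x : F | x != 0}, injective g.
  apply: exists_injection; rewrite card_ord card_sig.
  by rewrite (eq_card (B := predC1 0)) // cardC1 cardF -ltnS prednK ?expn_gt0.
pose M (r : {ffun 'I_t -> F}) (x : {x : F | x != 0}) :=
  l (\sum_j r j * val x ^+ j.*2.+1).
exists {ffun 'I_t -> F}, (fun r c => M r (g c)); split.
  by rewrite card_ffun card_ord cardF -expnM.
apply: (unbiased_col (M := M)) => // S cardS.
have [j pj] := odd_power_sum_neq0 char2 cardS.
set p := \sum_(x in S) _ in pj.
pose r0 : {ffun 'I_t -> F} := [ffun i => if i == j then z / p else 0].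
apply: (@sum_antisymmetric R {ffun 'I_t -> F} (fun r => r + r0)).
  exact: addIr.
have Mr0 : \sum_(x in S) M r0 x = 1.
  rewrite /M -lsum -lz; congr l.
  under eq_bigr => x _.
    rewrite (bigD1 j) //= big1 => [|i /negbTE neq]; last first.
      by rewrite ffunE neq mul0r.
    rewrite addr0 ffunE eqxx; over.
  by rewrite -mulr_sumr divfK.
move=> r; have MD x : M (r + r0) x = M r x + M r0 x.
  rewrite /M -lD -big_split; congr l; apply: eq_bigr => i _.
  by rewrite ffunE mulrDl.
under eq_bigr do rewrite MD sgnD.
by rewrite big_split /= -(sgn_sum R S (M r0)) Mr0 mulrN1.
Qed.

(** [unbiased_double] applied to the even case for one column less. *)
Lemma unbiased_bch_odd (R : numDomainType) (m t nu : nat) :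
  (0 < m)%N -> (nu <= 2 ^ m)%N ->
  exists (T : finType) (M : T -> 'I_nu -> 'I_2),
    #|T| = (2 ^ (m * t)).*2 /\ unbiased R t.*2.+1 M.
Proof.
move=> m0 le_nu.
have lt_pred : (nu.-1 < 2 ^ m)%N.
  by case: nu le_nu => [|nu] //=; rewrite expn_gt0.
have [T [M [cardT M0]]] := unbiased_bch R t m0 lt_pred.
have [g g_inj] : exists g : 'I_nu -> option 'I_nu.-1, injective g.
  by apply: exists_injection; rewrite card_option !card_ord leqSpred.
exists (T * 'I_2)%type, (fun rc c => oapp (M rc.1) 0 (g c) + rc.2); split.
  by rewrite card_prod cardT card_ord muln2.
exact: (unbiased_col g_inj (unbiased_double M0)).
Qed.

(** * The differential ratio of an instance *)

Lemma scope_inj (R : realType) (k q : nat) (I : csp R k q)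
    (i : 'I_(Defs.ncons I)) :
  injective (@scope R k q I i).
Proof.
move=> a b eq_ab; apply/val_inj; case: (ltngtP a b) => // /scope_incr.
  by rewrite eq_ab ltnn.
by rewrite eq_ab ltnn.
Qed.

(** Each constraint takes every pattern equally often over the rows of [L], as
    it does over all solutions ([unbiased_full]), hence has the same mean. *)
Lemma mean_value_unbiased (R : realType) (k : nat) (I : csp R k 2)
    (T : finType) (L : T -> solution I) :
  (0 < #|T|)%N ->
  (forall i, unbiased R (arity i)
     (fun r (a : 'I_(arity i)) => L r (scope a))) ->
  mean_value I = (\sum_r value (L r)) / #|T|%:R.
Proof.
have avg (U : finType) (K : U -> solution I) : (0 < #|U|)%N ->
    (forall i, unbiased R (arity i)
       (fun r (a : 'I_(arity i)) => K r (scope a))) ->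
    (\sum_r value (K r)) / #|U|%:R =
    \sum_(i < Defs.ncons I) weight i *
      ((\sum_(b : {ffun 'I_(arity i) -> 'I_2}) payoff b) / 2 ^+ arity i).
  move=> U0 K0; rewrite exchange_big mulr_suml; apply: eq_bigr => i _.
  rewrite -mulr_sumr -mulrA; congr (_ * _); apply/eqP.
  rewrite eqr_div ?expf_neq0 ?pnatr_eq0 -?lt0n //; apply/eqP.
  have cardA : #|'I_(arity i)| = arity i by rewrite card_ord.
  rewrite -[in 2 ^+ _]cardA (unbiased_uniform _ _ (K0 i)) ?cardA //.
  exact: mulrC.
move=> T0 L0; rewrite (avg T L) // /mean_value.
apply: (avg (solution I) id).
  by apply/card_gt0P; exists (default_solution I).
move=> i; apply: (unbiased_col (@scope_inj R k 2 I i)).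
exact: unbiased_full.
Qed.

Lemma opt_attained (R : realType) (k : nat) (I : csp R k 2) :
  exists x : solution I, value x = opt I.
Proof.
rewrite /opt; case: (csp_goal I).
  pose x0 := [arg max_(x > default_solution I) value x]%O.
  exists x0; apply/eqP; rewrite eq_le le_bigmax /=; apply/bigmax_leP.
  by rewrite /x0; case: arg_maxP => // x _ max_x; split=> [|y _]; exact: max_x.
pose x0 := [arg min_(x < default_solution I) value x]%O.
exists x0; apply/eqP; rewrite eq_le bigmin_le andbT; apply/bigmin_geP.
by rewrite /x0; case: arg_minP => // x _ min_x; split=> [|y _]; exact: min_x.
Qed.

Lemma differential_ratio_ge0 (R : realType) (k : nat) (I : csp R k 2)
    (x : solution I) : 0 <= (value x - wor I) / (opt I - wor I).
Proof.
have [min_le le_max] : min_value I <= value x /\ value x <= max_value I.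
  by rewrite bigmin_le le_bigmax.
have le_mm := le_trans min_le le_max.
rewrite /opt /wor; case: (csp_goal I).
  by rewrite divr_ge0 ?subr_ge0.
rewrite -[_ - _ in X in X / _]opprB -[_ - _ in X in _ / X]opprB.
by rewrite invrN mulrNN divr_ge0 ?subr_ge0.
Qed.

(** The normalised value of [differential_ratio_ge0] is nonnegative whether the
    goal is to maximize or to minimize, and it is 1 at an optimal solution. The
    average differential ratio is its mean over the [#|T|] shifts of an optimal
    solution, one of which is optimal. *)
Lemma average_differential_ratio_ge (R : realType) (k : nat) (I : csp R k 2)
    (T C : finType) (M : T -> C -> 'I_2) (c : 'I_(nvars I) -> C) :
  (0 < #|T|)%N -> unbiased R k M ->
  (forall i, injective (fun a : 'I_(arity i) => c (scope a))) ->
  opt I != wor I -> #|T|%:R^-1 <= average_differential_ratio I.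
Proof.
move=> T0 M0 c_inj neq.
have [x0 value_x0] := opt_attained I.
have [r0 _] := card_gt0P T0.
(* Subtracting the row [r0] makes it the one that leaves the optimum fixed. *)
pose L r : solution I := [ffun v => (x0 v - M r0 (c v)) + M r (c v)].
have Lr0 : L r0 = x0 by apply/ffunP => v; rewrite ffunE subrK.
have L0 i : unbiased R (arity i) (fun r (a : 'I_(arity i)) => L r (scope a)).
  have M0i := unbiased_col (c_inj i) M0.
  have le_k : (arity i <= k)%N.
    by have /andP[_] := arity_bounds i; rewrite leq_min => /andP[].
  have := unbiased_shift (fun a => x0 (scope a) - M r0 (c (scope a)))
                         (unbiased_leq le_k M0i).
  move=> sh S /sh shS; rewrite -[RHS]shS.
  apply: eq_bigr => r _; apply: eq_bigr => a _.
  by rewrite ffunE.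
have nzT : #|T|%:R != 0 :> R by rewrite pnatr_eq0 -lt0n.
have nz : opt I - wor I != 0 by rewrite subr_eq0.
rewrite /average_differential_ratio (mean_value_unbiased T0 L0).
have -> : (\sum_r value (L r)) / #|T|%:R - wor I =
          (\sum_r (value (L r) - wor I)) / #|T|%:R.
  by rewrite sumrB sumr_const mulrBl -[wor I *+ _]mulr_natr mulfK.
rewrite mulrAC mulr_suml -[leLHS]mul1r ler_pM2r ?invr_gt0 ?ltr0n //.
rewrite (bigD1 r0) //= Lr0 value_x0 divff // lerDl.
by apply: sumr_ge0 => r _; exact: differential_ratio_ge0.
Qed.

Lemma strong_color_map (R : realType) (k q : nat) (I : csp R k q) :
  exists c : 'I_(nvars I) -> 'I_(strong_chromatic_number I),
    forall i, injective (fun a : 'I_(arity i) => c (scope a)).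
Proof.
rewrite /strong_chromatic_number; case: ex_minnP => nu colorable _.
have /existsP[P /andP[/andP[partP rainbow] /eqP cardP]] := colorable.
have coverP v : v \in cover P by rewrite (cover_partition partP) inE.
have indexP v : (index (pblock P v) (enum P) < nu)%N.
  by rewrite -cardP cardE index_mem mem_enum pblock_mem.
exists (fun v => Ordinal (indexP v)) => i a b /(congr1 val)/= eq_index.
have eq_block : pblock P (scope a) = pblock P (scope b).
  have := congr1 (nth set0 (enum P)) eq_index.
  by rewrite !nth_index // mem_enum pblock_mem.
have /forallP/(_ i)/forall_inP/(_ _ (pblock_mem (coverP (scope a)))) := rainbow.
move/card_le1_eqP/(_ (scope a) (scope b)).
rewrite !inE mem_pblock coverP eq_block mem_pblock coverP !imset_f //.
by move=> /(_ isT isT)/scope_inj->.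
Qed.

(** * The bound *)

Lemma ceil_log2 (R : realType) (n : nat) :
  (1 < n)%N -> Num.ceil (log2 (n%:R : R)) = (up_log 2 n)%:Z.
Proof.
move=> n1; have n0 := ltnW n1.
have ln2 : 0 < ln (2 : R) by rewrite ln_gt0 // ltr1n.
have /andP[lt_n le_n] := up_log_bounds (isT : (1 < 2)%N) n1.
have m0 : (0 < up_log 2 n)%N by rewrite up_log_gt0.
have lnX2 (j : nat) : j%:R * ln 2 = ln (2 ^ j)%:R :> R.
  by rewrite natrX lnXn ?ltr0n // mulr_natl.
apply: ceil_def; rewrite -{1}(prednK m0) -addn1 PoszD addrK.
rewrite /log2 ltr_pdivlMr // ler_pdivrMr // -!pmulrn !lnX2.
by rewrite ltr_ln ?ler_ln ?posrE ?ltr0n ?expn_gt0 // ltr_nat ler_nat lt_n le_n.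
Qed.

Theorem corollary2p5 (R : realType) (k nu : nat) (hk : (4 <= k)%N)
    (I : csp R k 2) (hI : strong_chromatic_number I = nu)
    (hnu : (k <= nu)%N) (hne : opt I != wor I) :
  (~~ odd k ->
    average_differential_ratio I
      >= 1 / 2 ^ (Num.ceil (log2 (nu%:R + 1 : R)) * (k./2)%:Z) :> R
    /\ 1 / 2 ^ (Num.ceil (log2 (nu%:R + 1 : R)) * (k./2)%:Z)
      >= 1 / (2 * nu%:R) ^+ k./2 :> R)
  /\
  (odd k ->
    average_differential_ratio I
      >= 1 / 2 * (1 / 2 ^ (Num.ceil (log2 (nu%:R : R)) * ((k.-1)./2)%:Z)) :> R
    /\ 1 / 2 * (1 / 2 ^ (Num.ceil (log2 (nu%:R : R)) * ((k.-1)./2)%:Z))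
      >= 1 / 2 * (1 / (2 * nu%:R) ^+ (k.-1)./2) :> R).
Proof.
have nu4 : (4 <= nu)%N := leq_trans hk hnu.
have [c c_inj] := strong_color_map I; rewrite hI in c c_inj.
have bound n t : (1 < n)%N -> (n <= nu.+1)%N ->
    1 / (2 * nu%:R) ^+ t <= 1 / 2 ^ ((up_log 2 n)%:Z * t%:Z) :> R.
  move=> n1 le_n; have /andP[lt_n _] := up_log_bounds (isT : (1 < 2)%N) n1.
  have m0 : (0 < up_log 2 n)%N by rewrite up_log_gt0.
  have le2 : (2 ^ up_log 2 n <= 2 * nu)%N.
    by rewrite -(prednK m0) expnS leq_mul2l /= -ltnS (leq_trans lt_n).
  have nu_gt0 : (0 < 2 * nu)%N by rewrite muln_gt0 (leq_trans _ nu4).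
  rewrite !mul1r -PoszM -exprnP exprM -natrM -!natrX.
  rewrite lef_pV2 ?posrE ?ltr0n ?expn_gt0 ?nu_gt0 // ler_nat.
  by case: t => // t; rewrite leq_exp2r.
split=> [even_k|odd_k].
  have k_half : k = k./2.*2 by rewrite -{1}[k]odd_double_half (negbTE even_k).
  have nu1 : (1 < nu.+1)%N by rewrite ltnS (leq_trans _ nu4).
  rewrite natr1 (ceil_log2 _ nu1).
  split; last exact: bound.
  have m0 : (0 < up_log 2 nu.+1)%N by rewrite up_log_gt0.
  have [T [M [cardT M0]]] :=
    unbiased_bch R k./2 m0 (up_logP nu.+1 (isT : (1 < 2)%N)).
  have T0 : (0 < #|T|)%N by rewrite cardT expn_gt0.
  rewrite -k_half in M0.
  rewrite (le_trans _ (average_differential_ratio_ge T0 M0 c_inj hne)) //.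
  by rewrite cardT natrX mul1r -PoszM -exprnP.
have k_half : k = (k.-1./2.*2).+1.
  case: k odd_k {hk hnu I hI hne c c_inj} => //= j.
  by rewrite -{2}[j]odd_double_half => /negbTE->.
have nu1 : (1 < nu)%N by rewrite (leq_trans _ nu4).
rewrite (ceil_log2 _ nu1); split; last first.
  by rewrite ler_pM2l ?divr_gt0 // bound.
have m0 : (0 < up_log 2 nu)%N by rewrite up_log_gt0.
have [T [M [cardT M0]]] :=
  unbiased_bch_odd R k.-1./2 m0 (up_logP nu (isT : (1 < 2)%N)).
have T0 : (0 < #|T|)%N by rewrite cardT double_gt0 expn_gt0.
rewrite -k_half in M0.
rewrite (le_trans _ (average_differential_ratio_ge T0 M0 c_inj hne)) //.
by rewrite cardT -muln2 natrM natrX !mul1r -PoszM -exprnP invfM mulrC.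
Qed.
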